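(* Let $\sigma\in C([0,\infty);\mathbb{R})$ be such that the limit $L=\lim_{t\to\infty}\sigma^2(t)\log t$ exists in $[0,\infty]$. Let $\theta(n)\ge0$ be defined by $\theta^2(n)=\int_n^{n+1}\sigma^2(s)\,ds$ for integers $n\ge0$ and, for $\epsilon>0$, let $$S'(\epsilon)=\sum_{n=0}^\infty\theta(n)\exp\left(-\frac{\epsilon^2}{2}\frac{1}{\theta^2(n)}\right).$$ (A) If $L=0$, then $S'(\epsilon)<+\infty$ for all $\epsilon>0$. (B) If $L\in(0,\infty)$, then there exists $\epsilon'>0$ such that $S'(\epsilon)<+\infty$ for all $\epsilon>\epsilon'$ and $S'(\epsilon)=+\infty$ for all $\epsilon\in(0,\epsilon')$. (C) If $L=\infty$, then $S'(\epsilon)=+\infty$ for all $\epsilon>0$.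
   Context: In $S'(\epsilon)$ the summand is interpreted as $0$ when $\theta(n)=0$. *)

(* Defs.v *)
From HB Require Import structures.
From mathcomp Require Import all_boot all_order all_algebra.
From mathcomp Require Import all_classical all_reals all_analysis.

Set Implicit Arguments.
Unset Strict Implicit.
Unset Printing Implicit Defensive.

Import Order.TTheory GRing.Theory Num.Theory.
Import numFieldNormedType.Exports.

Local Open Scope classical_set_scope.
Local Open Scope ring_scope.

Definition Sprime_term (R : realType) (theta : nat -> R) (eps : R) (n : nat)
    : R :=
  if theta n == 0 then 0
  else theta n * expR (- (eps ^+ 2 / 2 * (1 / theta n ^+ 2))).

(* The terms are nonnegative when [theta] is, so the extended-real sum always
   exists and [< +oo] is convergence. *)
Definition Sprime (R : realType) (theta : nat -> R) (eps : R) : \bar R :=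
  (\sum_(0 <= n <oo) (Sprime_term theta eps n)%:E)%E.

(* Main.v *)
(** If [sigma^2 log] is eventually below (above) [M], then [theta(n)^2] is
    eventually at most [M / ln n] (at least [M / ln (n + 1)]), so the
    exponential factor in [S'(eps)] is at most [n ^ (- p)] (at least
    [(n + 1) ^ (- p)]) with [p = eps^2 / (2 M)]. For [p > 1] the prefactor
    [theta] is bounded and the series converges; for [p < 1] it is at least a
    multiple of [(n + 1) ^ (p - 1)], since [ln] is dominated by any power, and
    the series dominates the harmonic one. Letting [M] tend to [L] gives the
    threshold [eps' = sqrt (2 L)]. *)
Require Import Defs.
From HB Require Import structures.
From mathcomp Require Import all_boot all_order all_algebra.
From mathcomp Require Import all_classical all_reals all_analysis.
From mathcomp Require Import measurable_realfun ring lra.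

Set Implicit Arguments.
Unset Strict Implicit.
Unset Printing Implicit Defensive.

Import Order.TTheory GRing.Theory Num.Theory.
Import numFieldNormedType.Exports.

Local Open Scope classical_set_scope.
Local Open Scope ring_scope.


(** * Convergence and divergence by telescoping comparison *)

Section NonnegativeSeries.
Variables (R : realType) (u : nat -> R).
Hypothesis u_ge0 : forall n, 0 <= u n.

Lemma sum_tail_telescope_ge (F : nat -> R) (N n : nat) :
  (forall k, (N <= k)%N -> F k.+1 - F k <= u k) -> (N <= n)%N ->
  F n - F N <= \sum_(N <= k < n) u k.
Proof.
move=> uF Nn; rewrite -telescope_sumr// !big_nat.
by apply: ler_sum => k /andP[Nk _]; exact: uF.
Qed.

(** The partial sums from [N] on telescope to at most [F N - F n], hence to at most [F N]. *)
Lemma nneseries_lty_telescope (F : nat -> R) (N : nat) :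
  (forall n, 0 <= F n) -> (forall n, (N <= n)%N -> u n <= F n - F n.+1) ->
  (\sum_(0 <= n <oo) (u n)%:E < +oo)%E.
Proof.
move=> F_ge0 uF; rewrite (nneseries_split 0%N N)/=; last first.
  by move=> k _; rewrite lee_fin.
rewrite add0n sumEFin; apply: lte_add_pinfty; first exact: ltry.
apply: (@le_lt_trans _ _ (F N)%:E); last exact: ltry.
apply: lime_le; first by apply: is_cvg_nneseries => n _ _; rewrite lee_fin.
near=> n; rewrite sumEFin lee_fin.
have Nn : (N <= n)%N by near: n; exact: nbhs_infty_ge.
apply: (@le_trans _ _ (- F n - - F N)); last by have := F_ge0 n; lra.
rewrite -(telescope_sumr (fun k => - F k)) // !big_nat.
by apply: ler_sum => k /andP[Nk _]; have := uF _ Nk; lra.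
Unshelve. all: by end_near. Qed.

(** [F] need only be unbounded: each partial sum bounds the whole series from below, so one index
    per target [r] is enough. *)
Lemma nneseries_eqy_telescope (F : nat -> R) (N : nat) :
  (forall A, exists2 n, (N <= n)%N & A <= F n) ->
  (forall n, (N <= n)%N -> F n.+1 - F n <= u n) ->
  (\sum_(0 <= n <oo) (u n)%:E = +oo)%E.
Proof.
move=> F_unbounded uF; apply: eq_infty => r.
have [n Nn rF] := F_unbounded (r + F N).
have un0 k : (0 <= (u k)%:E)%E by rewrite lee_fin.
apply: le_trans (nneseries_lim_ge n _) => //.
rewrite sumEFin lee_fin (big_cat_nat (n := N))//=.
apply: (@le_trans _ _ (F n - F N)); first lra.
apply: le_trans (sum_tail_telescope_ge uF Nn) _.
by rewrite lerDr sumr_ge0.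
Qed.

End NonnegativeSeries.

(** * The series when [theta n ^+ 2] is compared with [M / ln n] *)

Section LogarithmicThreshold.
Variable R : realType.
Implicit Types (eps M q : R) (theta : nat -> R) (n N : nat).

(** The graph of [ln] lies below its tangent at [b]. Taking [a < b] bounds an increment of [ln] from
    below, [a > b] from above. *)
Lemma lnB_le (a b : R) : 0 < a -> 0 < b -> ln a - ln b <= (a - b) / b.
Proof.
move=> a0 b0; rewrite -ln_div ?posrE//.
have -> : a / b = 1 + (a - b) / b by field; rewrite gt_eqF.
apply: le_ln1Dx; have := divr_gt0 a0 b0.
have -> : (a - b) / b = a / b - 1 by field; rewrite gt_eqF.
lra.
Qed.

(* [n ^ (- (1 + q))] against the telescoping differences of [n ^ (- q)]. *)
Lemma expR_ln_telescope q n : 0 < q -> (1 < n)%N ->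
  q * expR (- ((1 + q) * ln n%:R)) <=
  expR (- (q * ln n.-1%:R)) - expR (- (q * ln n%:R)).
Proof.
move=> q0; case: n => [|[|m]]// _.
have m1_gt0 : 0 < m.+1%:R :> R by rewrite ltr0n.
have m2_gt0 : 0 < m.+2%:R :> R by rewrite ltr0n.
rewrite succnK; set x := ln m.+2%:R; set y := ln m.+1%:R.
have inv_le : expR (- x) <= x - y.
  have := lnB_le m1_gt0 m2_gt0; rewrite -/x -/y.
  have -> : m.+1%:R - m.+2%:R = -1 :> R by rewrite -[m.+2%:R]natr1; ring.
  by rewrite mulN1r expRN lnK ?posrE// -opprB lerN2.
(* With [expR (- (q * x))] factored out, there remains [q * expR (- x) <= expR (q * (x - y)) - 1],
   which follows from [inv_le] and [1 + u <= expR u]. *)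
rewrite (_ : - ((1 + q) * x) = - x - q * x); last by ring.
rewrite (_ : - (q * y) = q * (x - y) - q * x); last by ring.
rewrite !expRD mulrA -[X in _ <= _ - X]mul1r -mulrBl.
apply: ler_wpM2r; first exact: expR_ge0.
apply: (@le_trans _ _ (q * (x - y))); first by rewrite ler_pM2l.
by have := expR_ge1Dx (q * (x - y)); lra.
Qed.

Lemma Sprime_term_ge0 theta eps n : 0 <= theta n -> 0 <= Sprime_term theta eps n.
Proof.
by move=> t0; rewrite /Sprime_term; case: ifP => // _; rewrite mulr_ge0 ?expR_ge0.
Qed.

Lemma Sprime_lty theta eps M N : (forall n, 0 <= theta n) ->
  0 < M -> 2 * M < eps ^+ 2 -> (1 < N)%N ->
  (forall n, (N <= n)%N -> theta n ^+ 2 <= M / ln n%:R) ->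
  (Sprime theta eps < +oo)%E.
Proof.
move=> theta0 M0 Meps N1 thetaM.
(* The excess over 1 of the exponent [eps ^+ 2 / (2 * M)]. *)
pose q := eps ^+ 2 / (2 * M) - 1.
have q0 : 0 < q by rewrite subr_gt0 ltr_pdivlMr ?mul1r// mulr_gt0.
(* Bounds [theta n] for [n >= N], by [t <= 1 + t ^+ 2] and [ln 2 <= ln n]. *)
pose K := 1 + M / ln 2.
have ln2 : 0 < ln 2 :> R by rewrite ln_gt0// ltr1n.
have K0 : 0 < K by rewrite addr_gt0// divr_gt0.
(* The predecessor makes [F n - F n.+1] the difference in [expR_ln_telescope]; [1 < N] keeps [n.-1]
   positive where it is used. *)
pose F n := K / q * expR (- (q * ln n.-1%:R)).
apply: (@nneseries_lty_telescope _ _ _ F N) => [n|n|n Nn].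
- exact: Sprime_term_ge0.
- by rewrite mulr_ge0 ?expR_ge0// divr_ge0 ?ltW.
have n1 : (1 < n)%N by apply: leq_trans N1 Nn.
have lnn : 0 < ln n%:R :> R by rewrite ln_gt0// ltr1n.
apply: (@le_trans _ _ (K * expR (- ((1 + q) * ln n%:R)))); last first.
  rewrite /F succnK -mulrBr -mulrA ler_pM2l// [leRHS]mulrC.
  rewrite ler_pdivlMr// [leLHS]mulrC.
  exact: expR_ln_telescope.
rewrite /Sprime_term; case: eqP => [_|/eqP tn0].
  by rewrite mulr_ge0 ?expR_ge0// ltW.
have t0 : 0 < theta n by rewrite lt_neqAle eq_sym tn0 theta0.
have tM := thetaM _ Nn.
apply: ler_pM; rewrite ?expR_ge0//.
  have : M / ln n%:R <= M / ln 2.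
    rewrite ler_pM2l// lef_pV2 ?posrE// ler_ln ?posrE ?ltr0n// ?ler_nat//.
    exact: ltnW.
  by rewrite /K; nra.
rewrite ler_expR lerN2 mul1r.
have -> : 1 + q = eps ^+ 2 / 2 / M by rewrite /q; field; rewrite gt_eqF.
rewrite -mulrA ler_wpM2l ?divr_ge0 ?sqr_ge0// mulrC.
by rewrite -[leLHS]invf_div lef_pV2 ?posrE ?exprn_gt0 ?divr_gt0.
Qed.

Lemma Sprime_eqy theta eps M N : (forall n, 0 <= theta n) ->
  0 < M -> eps ^+ 2 < 2 * M -> (0 < N)%N ->
  (forall n, (N <= n)%N -> M / ln n.+1%:R <= theta n ^+ 2) ->
  Sprime theta eps = +oo%E.
Proof.
move=> theta0 M0 Meps N0 thetaM.
pose d := 1 - eps ^+ 2 / (2 * M).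
have d0 : 0 < d by rewrite subr_gt0 ltr_pdivrMr ?mul1r// mulr_gt0.
(* The bound 1 serves the indices with [theta n >= 1], the bound [M * d] the others. *)
pose c := Num.min 1 (M * d).
have c0 : 0 < c by rewrite lt_min ltr01 mulr_gt0.
apply: (@nneseries_eqy_telescope _ _ _ (fun n => c * ln n.+1%:R) N) => [n|A|n Nn].
- exact: Sprime_term_ge0.
(* Chosen so that [n.+1] is at least [expR (A / c)]. *)
- exists (N + Num.truncn (expR (A / c)))%N; first exact: leq_addr.
  rewrite mulrC -ler_pdivrMr// -[leLHS]expRK ler_ln ?posrE ?expR_gt0 ?ltr0n//.
  apply: (le_trans (ltW (truncnS_gt _))).
  by rewrite ler_nat ltnS leq_addl.
have n0 : (0 < n)%N by apply: leq_trans N0 Nn.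
set x := n.+1%:R in thetaM *.
have x0 : 0 < x :> R by rewrite ltr0n.
have lnx : 0 < ln x by rewrite ln_gt0// ltr1n ltnS.
have tM := thetaM _ Nn; rewrite -/x in tM.
have tn0 : 0 < theta n.
  rewrite lt_neqAle theta0 andbT; apply/eqP => t0; move: tM.
  by rewrite -t0 expr0n/= leNgt divr_gt0.
apply: (@le_trans _ _ (c * expR (- ln x))).
  rewrite -mulrBr ler_pM2l// expRN lnK ?posrE//.
  have := @lnB_le n.+2%:R x (ltr0Sn _ _) x0.
  by rewrite -[n.+2%:R]natr1 -/x addrAC subrr add0r mul1r.
rewrite /Sprime_term gt_eqF//.
(* The first factor of [1 / x] is to be absorbed by the prefactor [theta n], the second by the
   exponential. *)
have -> : - ln x = - (d * ln x) - (1 - d) * ln x by ring.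
rewrite expRD mulrA; apply: ler_pM; rewrite ?expR_ge0 ?mulr_ge0 ?expR_ge0 ?(ltW c0)//.
  have [t1|t1] := leP 1 (theta n).
    apply: le_trans t1; rewrite -[leRHS]mulr1 ler_pM ?expR_ge0 ?(ltW c0)//.
      by rewrite ge_min lexx.
    by rewrite -[leRHS]expR0 ler_expR oppr_le0 mulr_ge0// ltW.
  (* For [theta n < 1] the square is the smaller; it is at least [M / ln x], and
     [d * ln x <= expR (d * ln x)] concludes. *)
  apply: (@le_trans _ _ (theta n ^+ 2)); last by nra.
  apply: le_trans tM.
  apply: (@le_trans _ _ (M * d * expR (- (d * ln x)))).
    by rewrite ler_wpM2r ?expR_ge0// ge_min lexx orbT.
  rewrite -mulrA ler_pM2l// expRN ler_pdivrMr ?expR_gt0// mulrC ler_pdivlMr//.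
  by have := expR_ge1Dx (d * ln x); lra.
rewrite ler_expR lerN2 mul1r.
have -> : 1 - d = eps ^+ 2 / 2 / M by rewrite /d; field; rewrite gt_eqF.
rewrite -[leRHS]mulrA ler_wpM2l ?divr_ge0 ?sqr_ge0// mulrC.
by rewrite -[leRHS]invf_div lef_pV2 ?posrE ?exprn_gt0 ?divr_gt0.
Qed.

End LogarithmicThreshold.

(** * Pointwise bounds passed to integrals over intervals of length one *)

Section UnitIntervalMean.
Variables (R : realType) (sigma : R -> R) (a c : R).
Hypothesis sigma_cont : {within `[a, a + 1], continuous sigma}.
Let mu := @lebesgue_measure R.

Let integral_cst_itv : (\int[mu]_(s in `[a, (a + 1)%R]) (cst c%:E) s = c%:E)%E.
Proof.
rewrite integral_cst//= lebesgue_measure_itv/= lte_fin ltrDl ltr01.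
by rewrite -EFinB addrAC subrr add0r mule1.
Qed.

Let measurable_sqr : measurable_fun `[a, a + 1] (fun s => sigma s ^+ 2).
Proof. by apply: measurable_funX; exact: subspace_continuous_measurable_fun. Qed.

Lemma integral_sqr_le : (forall s, a <= s <= a + 1 -> sigma s ^+ 2 <= c) ->
  (\int[mu]_(s in `[a, (a + 1)%R]) (sigma s ^+ 2)%:E <= c%:E)%E.
Proof.
move=> sc; rewrite -[leRHS]integral_cst_itv.
have c_ge0 : 0 <= c.
  by apply: le_trans (sc a _); rewrite ?sqr_ge0// lexx lerDl ler01.
apply: ge0_le_integral => //=.
- by move=> s _; rewrite lee_fin sqr_ge0.
- exact/measurable_EFinP.
Qed.

Lemma integral_sqr_ge : 0 <= c -> (forall s, a <= s <= a + 1 -> c <= sigma s ^+ 2) ->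
  (c%:E <= \int[mu]_(s in `[a, (a + 1)%R]) (sigma s ^+ 2)%:E)%E.
Proof.
move=> c_ge0 sc; rewrite -[leLHS]integral_cst_itv.
by apply: ge0_le_integral => //=; exact/measurable_EFinP.
Qed.

End UnitIntervalMean.

(** * From the limit [L] to eventual bounds on [theta] *)

Section Asymptotics.
Variables (R : realType) (sigma : R -> R) (L : \bar R) (theta : nat -> R).
Hypothesis sigma_cont : {within `[0, +oo[, continuous sigma}.
Hypothesis L_lim : (sigma t ^+ 2 * ln t)%:E @[t --> +oo] --> L.
Hypothesis theta_sq : forall n : nat,
  ((theta n ^+ 2)%:E =
   \int[lebesgue_measure]_(s in `[n%:R, n.+1%:R]) (sigma s ^+ 2)%:E)%E.

Let sigma_cont_itv n : {within `[n%:R, n%:R + 1], continuous sigma}.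
Proof.
apply: continuous_subspaceW sigma_cont => s /=.
by rewrite !in_itv/= andbT => /andP[/(le_trans _)->//]; rewrite ler0n.
Qed.

Let nat_threshold (P : R -> Prop) : (\forall t \near +oo, P t) ->
  exists2 N, (1 < N)%N & forall n t, (N <= n)%N -> n%:R <= t -> P t.
Proof.
(* Adding 2 puts the threshold above both [A] and 1, so logarithms beyond it are positive. *)
move=> [A [_ AP]]; exists (Num.truncn A).+2 => // n t Nn nt; apply: AP.
apply: lt_le_trans nt; apply: lt_le_trans (truncnS_gt _) _.
by rewrite ler_nat ltnW.
Qed.

(** On the interval from [n] to [n + 1], [ln s] is at least its value at the left endpoint; the
    lower bound below uses the right endpoint instead. *)
Lemma theta_sq_le M : (L < M%:E)%E ->
  exists2 N, (1 < N)%N & forall n, (N <= n)%N -> theta n ^+ 2 <= M / ln n%:R.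
Proof.
move=> LM; have [N N1 NP] := nat_threshold (L_lim (open_ereal_lt' LM)).
exists N => // n Nn; have n1 : (1 < n)%N by apply: leq_trans Nn.
have n_gt0 : 0 < n%:R :> R by rewrite ltr0n ltnW.
rewrite -lee_fin theta_sq -natr1; apply: integral_sqr_le => // s /andP[ns _].
rewrite ler_pdivlMr ?ln_gt0 ?ltr1n//.
have := NP n s Nn ns; rewrite /= lte_fin => /ltW; apply: le_trans.
by rewrite ler_wpM2l ?sqr_ge0// ler_ln ?posrE// (lt_le_trans n_gt0).
Qed.

Lemma theta_sq_ge M : 0 < M -> (M%:E < L)%E ->
  exists2 N, (1 < N)%N & forall n, (N <= n)%N -> M / ln n.+1%:R <= theta n ^+ 2.
Proof.
move=> M0 LM; have [N N1 NP] := nat_threshold (L_lim (open_ereal_gt' LM)).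
exists N => // n Nn; have n1 : (1 < n)%N by apply: leq_trans Nn.
have n_gt0 : 0 < n%:R :> R by rewrite ltr0n ltnW.
have lnn : 0 < ln n.+1%:R :> R by rewrite ln_gt0// ltr1n ltnS ltnW.
rewrite -lee_fin theta_sq -[X in `[_, X]]natr1.
apply: integral_sqr_ge => //; first by rewrite divr_ge0 ?ltW.
move=> s /andP[ns sn].
rewrite ler_pdivrMr//.
have := NP n s Nn ns; rewrite /= lte_fin => /ltW /le_trans; apply.
rewrite ler_wpM2l ?sqr_ge0// ler_ln ?posrE ?ltr0n ?(lt_le_trans n_gt0)//.
by rewrite -natr1.
Qed.

End Asymptotics.

Theorem proposition3 (R : realType) (sigma : R -> R) (L : \bar R)
    (theta : nat -> R)
    (sigma_cont : {within `[0, +oo[, continuous sigma})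
    (L_ge0 : (0 <= L)%E)
    (L_lim : (sigma t ^+ 2 * ln t)%:E @[t --> +oo] --> L)
    (theta_ge0 : forall n : nat, 0 <= theta n)
    (theta_sq : forall n : nat,
      ((theta n ^+ 2)%:E =
       \int[lebesgue_measure]_(s in `[n%:R, n.+1%:R]) (sigma s ^+ 2)%:E)%E) :
  [/\ L = 0%E -> forall eps : R, 0 < eps -> (Sprime theta eps < +oo)%E,
      (0 < L < +oo)%E ->
        exists eps' : R, [/\ 0 < eps',
          forall eps : R, eps' < eps -> (Sprime theta eps < +oo)%E &
          forall eps : R, 0 < eps < eps' -> Sprime theta eps = +oo%E] &
      L = +oo%E -> forall eps : R, 0 < eps -> Sprime theta eps = +oo%E].
Proof.
(* Any positive [M] strictly between [L] and [eps ^+ 2 / 2] gives convergence, and with the order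
   reversed divergence. Each regime then only selects [M]. *)
have sumy eps M : (L < M%:E)%E -> 0 < M -> 2 * M < eps ^+ 2 -> (Sprime theta eps < +oo)%E.
  move=> LM M0 Meps; have [N N1 thetaM] := theta_sq_le sigma_cont L_lim theta_sq LM.
  exact: Sprime_lty thetaM.
have sumNy eps M : (M%:E < L)%E -> 0 < M -> eps ^+ 2 < 2 * M -> Sprime theta eps = +oo%E.
  move=> LM M0 Meps.
  have [N /ltnW N0 thetaM] := theta_sq_ge sigma_cont L_lim theta_sq M0 LM.
  exact: Sprime_eqy thetaM.
split=> [L0 eps eps0|/andP[]|Loo eps eps0].
- apply: (sumy _ (eps ^+ 2 / 4)).
  + by rewrite L0 lte_fin divr_gt0 ?exprn_gt0.
  + by rewrite divr_gt0 ?exprn_gt0.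
  + by have := exprn_gt0 2 eps0; lra.
- case: L sumy sumNy {L_ge0 L_lim} => [l| |]// sumy sumNy.
  rewrite lte_fin => l0 _.
  have l2 : 0 < 2 * l by rewrite mulr_gt0.
  have sqrt_sq : Num.sqrt (2 * l) ^+ 2 = 2 * l by rewrite sqr_sqrtr// ltW.
  have s0 : 0 < Num.sqrt (2 * l) by rewrite sqrtr_gt0.
  exists (Num.sqrt (2 * l)); split=> // eps.
    move=> seps; have : 2 * l < eps ^+ 2 by rewrite -sqrt_sq; nra.
    (* [M] is the midpoint of [l] and [eps ^+ 2 / 2], a choice that also serves below the
       threshold. *)
    by move=> ?; apply: (sumy _ ((l + eps ^+ 2 / 2) / 2)); rewrite ?lte_fin; lra.
  move=> /andP[eps0 epss]; have : eps ^+ 2 < 2 * l by rewrite -sqrt_sq; nra.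
  have := exprn_gt0 2 eps0 => ? ?.
  by apply: (sumNy _ ((l + eps ^+ 2 / 2) / 2)); rewrite ?lte_fin; lra.
- have := exprn_gt0 2 eps0 => ?.
  by apply: (sumNy _ (eps ^+ 2)); [rewrite Loo ltry|lra|lra].
Qed.
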